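(* Let $C$ be a normal cone with nonempty interior $\operatorname{int}C$ in a real Banach space $(X,\|\cdot\|)$. Let $f:\operatorname{int}C\to\operatorname{int}C$ be positively homogeneous ($f(tx)=tf(x)$ for all $t>0$) and order preserving ($x\le y$ implies $f(x)\le f(y)$). Let $S=\{x\in\operatorname{int}C\mid f(x)=x\}$, and assume that $v\in S$. Assume that $f$ is semidifferentiable at $v$ with $\tilde r(f'_v)<1$, where $\tilde r$ is the spectral radius defined with respect to the seminorm $\omega_v$. Then, for all $x\in\operatorname{int}C$, $$\limsup_{k\to\infty}d(f^k(x),v)^{1/k}\le\tilde r(f'_v),$$ where $d$ is Hilbert's projective metric, and there is a scalar $\lambda>0$ (depending on $x$) such that $$\limsup_{k\to\infty}\bar d(f^k(x),\lambda v)^{1/k}\le\tilde r(f'_v),$$ where $\bar d$ is Thompson's metric.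
   Context: Cones: a subset $C\subset X$ is a cone if $tC\subset C$ for all $t\ge0$. It is proper if it is closed, convex and pointed ($C\cap(-C)=\{0\}$); it then defines the partial order $x\le y\iff y-x\in C$. It is normal if it is proper and there is a constant $M$ with $\|x\|\le M\|y\|$ whenever $0\le x\le y$. Metrics: for $x,y\in\operatorname{int}C$, let $M(y/x)=\inf\{b\in\mathbb R\mid y\le bx\}$ and $m(y/x)=\sup\{a\in\mathbb R\mid ax\le y\}$. Hilbert's projective metric is $d(x,y)=\log M(y/x)-\log m(y/x)$ and Thompson's metric is $\bar d(x,y)=\max(\log M(y/x),-\log m(y/x))$. Seminorm: for $v\in\operatorname{int}C$ and $x\in X$, $\omega_v(x)=\inf\{b-a\mid a,b\in\mathbb R,\ av\le x\le bv\}$. Spectral radius with respect to a seminorm $\omega$ on $X$: for a positively homogeneous self-map $h$ of $X$, $\omega(h)=\sup\{\omega(h(x))/\omega(x)\mid x\in X,\ \omega(x)\ne0\}\in[0,+\infty]$ and $\tilde r(h)=\lim_{k\to\infty}\omega(h^k)^{1/k}$, where $h^k$ denotes the $k$-th iterate. Semidifferentiability: let $G\subset X$ and $v$ an interior point of $G$. A map $f:G\to X$ is semidifferentiable at $v$ if there exists a continuous, positively homogeneous map $h:X\to X$ such that $f(v+x)=f(v)+h(x)+o(\|x\|)$ as $x\to0$. Such $h$ is unique and denoted $f'_v$ (the semidifferential of $f$ at $v$). *)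

(* Defs.v *)
From mathcomp Require Import all_boot all_order all_algebra.
From mathcomp Require Import all_classical all_reals all_analysis.

Set Implicit Arguments.
Unset Strict Implicit.
Unset Printing Implicit Defensive.

Import Order.TTheory GRing.Theory Num.Theory.
Import numFieldNormedType.Exports.

Local Open Scope classical_set_scope.
Local Open Scope ring_scope.

Section Cones.
Context {R : realType} {X : completeNormedModType R}.
Implicit Types (C : set X) (x y v : X) (f h : X -> X).

Definition is_cone C := forall (t : R) x, 0 <= t -> C x -> C (t *: x).

Definition proper_cone C :=
  [/\ is_cone C, closed C, convex_set (C : set (convex_lmodType X))
    & C `&` -%R @` C = [set 0]].

Definition cone_le C x y := C (y - x).

Definition normal_cone C :=
  proper_cone C /\
  exists M : R, forall x y,
    cone_le C 0 x -> cone_le C x y -> `|x| <= M * `|y|.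

(* cone_M C y x is M(y/x) and cone_m C y x is m(y/x).  If C is proper, X != 0
   and x, y are interior to C, then the sets below are nonempty and bounded
   and the two values are positive; if X = 0, the conventions inf setT = 0,
   sup setT = 0 and ln 0 = 0 make both metrics vanish. *)
Definition cone_M C y x : R := inf [set b : R | cone_le C y (b *: x)].

Definition cone_m C y x : R := sup [set a : R | cone_le C (a *: x) y].

Definition hilbert_metric C x y : R := ln (cone_M C y x) - ln (cone_m C y x).

Definition thompson_metric C x y : R :=
  Num.max (ln (cone_M C y x)) (- ln (cone_m C y x)).

Definition cone_omega C v x : R :=
  inf [set r : R | exists a b : R,
    [/\ cone_le C (a *: v) x, cone_le C x (b *: v) & r = b - a]].

Definition order_preserving_on C (G : set X) f :=
  forall x y, G x -> G y -> cone_le C x y -> cone_le C (f x) (f y).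

Definition pos_homogeneous_on (G : set X) f :=
  forall (t : R) x, 0 < t -> G x -> f (t *: x) = t *: f x.

(* The supremum is taken in [0, +oo], so the empty supremum is 0. *)
Definition seminorm_of_map (omega : X -> R) h : \bar R :=
  ereal_sup (0%E |` [set (omega (h x) / omega x)%:E | x in
                     [set x : X | omega x != 0]]).

Definition spectral_radius (omega : X -> R) h : \bar R :=
  limn (fun k : nat =>
    poweR (seminorm_of_map omega (iter k h)) (k%:R^-1 : R)).

(* A map G -> X is represented by a total map f; since v is interior to G,
   only the values of f on G matter. *)
Definition is_semidifferential (G : set X) f v h :=
  [/\ G° v, continuous h, pos_homogeneous_on setT h
    & (fun x => f (v + x) - f v - h x) =o_ (0 : X) (id : X -> X)].

Definition semidifferentiable (G : set X) f v :=
  exists h, is_semidifferential G f v h.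

Definition semidifferential (G : set X) f v : X -> X :=
  xget (fun=> 0) (is_semidifferential G f v).

Lemma semidifferential_unique (G : set X) f v h1 h2 :
  is_semidifferential G f v h1 -> is_semidifferential G f v h2 -> h1 = h2.
Proof.
move=> [_ _ hom1 /eqoP o1] [_ _ hom2 /eqoP o2]; apply/funext => x.
apply/eqP; rewrite -subr_eq0 -normr_le0; apply/ler_addgt0Pr => e e0.
rewrite add0r.
have d0 : 0 < e / 2 / (1 + `|x|) by rewrite !divr_gt0// ltr_wpDr.
have cvx : (fun t : R => t *: x) @ 0^'+ --> (0 : X).
  apply: cvg_at_right_filter; rewrite -(scale0r x).
  exact: cvgZr_tmp.
near (0 : R)^'+ => t.
have t0 : 0 < t by near: t; exact: nbhs_right_gt.
have n1 : `|f (v + t *: x) - f v - h1 (t *: x)|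
           <= e / 2 / (1 + `|x|) * `|t *: x|.
  near: t; exact: (cvx _ (o1 _ d0)).
have n2 : `|f (v + t *: x) - f v - h2 (t *: x)|
           <= e / 2 / (1 + `|x|) * `|t *: x|.
  near: t; exact: (cvx _ (o2 _ d0)).
have := lerD n2 n1; move=> /(le_trans (ler_normB _ _)).
have -> : f (v + t *: x) - f v - h2 (t *: x)
          - (f (v + t *: x) - f v - h1 (t *: x)) = h1 (t *: x) - h2 (t *: x).
  by rewrite opprB addrC addrA subrK.
rewrite hom1// hom2// -scalerBr !normrZ gtr0_norm// -mulrDl -mulrDl -splitr.
rewrite mulrCA ler_pM2l// => /le_trans; apply.
rewrite -mulrA ler_piMr ?(ltW e0)// mulrC ler_pdivrMr ?mul1r ?ltr_wpDr//.
by rewrite lerDr.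
Unshelve. all: by end_near.
Qed.

End Cones.

(* Main.v *)
(* Write t(x) and b(x) for the largest and smallest scalars with
   b(x) v <= x <= t(x) v, so that omega_v = t - b, d(x,v) = ln t(x) - ln b(x),
   and f decreases t and increases b.  The semidifferential h is order
   preserving and commutes with adding multiples of v, hence is nonexpansive for
   the order-unit norm of v; this lets the first-order expansion of f at v be
   iterated, without any compactness.  If tilde r(h) < s < 1, some iterate h^n
   contracts omega_v by less than s^n, so F = f^n satisfies
   omega_v(F u) <= s^n omega_v(u) on a region omega_v(u) <= delta b(u), which F
   preserves.  Any x enters that region: comparing x with the point of the
   segment from v to x / b(x) lying on the boundary of the region shows that F
   shrinks t/b by a fixed factor as long as the region is not reached.  Hence
   omega_v(f^k x) = O(s^k).  Any lambda between sup_k b(f^k x) and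
   inf_k t(f^k x) makes Thompson's distance from f^k x to lambda v at most
   Hilbert's distance from f^k x to v. *)
Require Import Defs.
From mathcomp Require Import all_boot all_order all_algebra.
From mathcomp Require Import all_classical all_reals all_analysis.
From mathcomp Require Import ring lra zify.
Import Order.TTheory GRing.Theory Num.Theory.
Import numFieldNormedType.Exports.
Local Open Scope classical_set_scope.
Local Open Scope ring_scope.
Set Implicit Arguments.
Unset Strict Implicit.
Unset Printing Implicit Defensive.

(** * Geometric bounds and k-th roots of real sequences *)

Section RootSequences.
Context {R : realType}.
Implicit Types (u w a : nat -> R) (s t K W : R).

Lemma limn_esup_le_near (u : nat -> \bar R) (l : \bar R) :
  (\forall n \near \oo, (u n <= l)%E) -> (limn_esup u <= l)%E.
Proof.
move=> ul; apply: (@le_trans _ _ (ereal_sup (u @` [set n | (u n <= l)%E]))).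
  by apply: ereal_inf_lbound; exists [set n | (u n <= l)%E].
by apply: ge_ereal_sup => _ [n /= un <-].
Qed.

Lemma powR_exprn_inv s k : 0 <= s -> (0 < k)%N -> powR (s ^+ k) k%:R^-1 = s.
Proof.
move=> s0 k0; rewrite -powR_mulrn// -powRrM divff ?powRr1//.
by rewrite pnatr_eq0 -lt0n.
Qed.

Lemma near_root_le u K s t : (forall k, 0 <= u k) ->
  (forall k, u k <= K * s ^+ k) -> 0 <= s -> s < t ->
  \forall k \near \oo, powR (u k) k%:R^-1 <= t.
Proof.
move=> u0 uK s0 st.
have t0 : 0 < t by exact: le_lt_trans st.
have q1 : `|s / t| < 1 by rewrite ger0_norm ?divr_ge0 ?(ltW t0)// ltr_pdivrMr ?mul1r.
have K0 : 0 < (1 + `|K|)^-1 by rewrite invr_gt0 ltr_wpDr.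
have /cvgrPdist_lt/(_ _ K0) := cvg_expr q1.
move=> near_q; near=> k.
have k0 : (0 < k)%N by near: k; exact: nbhs_infty_gt.
rewrite -[leRHS](@powR_exprn_inv t k) ?(ltW t0)//.
have ki0 : 0 <= k%:R^-1 :> R by rewrite invr_ge0.
apply: (ge0_ler_powR ki0); rewrite ?nnegrE ?exprn_ge0 ?(ltW t0)//.
apply: (le_trans (uK k)).
have : `|0 - (s / t) ^+ k| < (1 + `|K|)^-1 by near: k.
rewrite sub0r normrN ger0_norm ?exprn_ge0 ?divr_ge0 ?(ltW t0)//.
rewrite expr_div_n ltr_pdivrMr ?exprn_gt0// => /ltW sk.
have sk0 : 0 <= s ^+ k by exact: exprn_ge0.
have := ler_wpM2l (addr_ge0 ler01 (normr_ge0 K)) sk.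
rewrite mulrA divff ?mul1r; last by rewrite gt_eqF// ltr_wpDr.
apply: le_trans; apply: ler_wpM2r => //.
by rewrite (le_trans (ler_norm K))// lerDr.
Unshelve. all: by end_near.
Qed.

(** Monotonicity spreads the bound from the progression [N + n * j] to every index. The exponent
    then lags behind the index by at most [N + n], whence the constant [W / s ^+ (N + n)]. *)
Lemma nonincreasing_geometric_bound w s n N W :
  (forall k, w k.+1 <= w k) -> 0 < s -> s < 1 -> (0 < n)%N ->
  0 <= W -> w 0%N <= W ->
  (forall j, w (N + n * j)%N <= W * s ^+ (n * j)) ->
  exists K, forall k, w k <= K * s ^+ k.
Proof.
move=> wdec s0 s1 n0 W0 w0W wN; exists (W / s ^+ (N + n)) => k.
have decw : {homo w : i j / (i <= j)%N >-> j <= i}.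
  by apply: (homo_leq (r := fun x y => y <= x)) => // x y z xy yz; exact: le_trans xy.
have sp i : 0 < s ^+ i by exact: exprn_gt0.
rewrite mulrAC ler_pdivlMr//.
have key m i : w k <= W * s ^+ m -> (k <= m + i)%N ->
    w k * s ^+ i <= W * s ^+ k.
  move=> wm km; apply: (@le_trans _ _ (W * s ^+ m * s ^+ i)).
    by rewrite ler_wpM2r ?(ltW (sp _)).
  by rewrite -mulrA -exprD ler_wpM2l// ler_wiXn2l// ltW.
have [kN|Nk] := leqP k N.
  apply: (key 0%N); last by rewrite add0n (leq_trans kN)// leq_addr.
  by rewrite expr0 mulr1 (le_trans _ w0W)// decw.
(* [N] plus this exponent is the last term of the progression not exceeding [k]. *)
apply: (key (n * ((k - N) %/ n))%N).
  by apply: le_trans (wN _); apply: decw; move: (divn_eq (k - N) n); lia.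
by move: (divn_eq (k - N) n) (ltn_pmod (k - N) n0); lia.
Qed.

(* Fekete's lemma, for sequences bounded by 1. *)
Lemma submultiplicative_root_cvg a : (forall n, 0 <= a n <= 1) ->
  (forall m n, a (m + n)%N <= a m * a n) ->
  exists L : R, [/\ 0 <= L,
    (fun k : nat => powR (a k) k%:R^-1) @ \oo --> L &
    forall s, L < s -> exists2 n, (0 < n)%N & a n < s ^+ n].
Proof.
move=> a01 amul.
have a0 n : 0 <= a n by case/andP: (a01 n).
have a1 n : a n <= 1 by case/andP: (a01 n).
pose E := [set powR (a k) k%:R^-1 | k in [set k | (0 < k)%N]].
have E0 : E !=set0 by exists (powR (a 1%N) 1%:R^-1), 1%N.
have lbE : has_lbound E by exists 0 => _ [k _ <-]; exact: powR_ge0.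
have infE k : (0 < k)%N -> inf E <= powR (a k) k%:R^-1.
  by move=> k0; apply: ge_inf => //; exists k.
have Ltwit s : inf E < s -> exists2 n, (0 < n)%N & a n < s ^+ n.
  move=> Ls; have [_ [n n0 <-]] := inf_lt E0 Ls.
  move=> ans; exists n => //.
  have s0 : 0 < s by apply: le_lt_trans ans; exact: powR_ge0.
  have nR0 : 0 < n%:R :> R by rewrite ltr0n.
  have := fun h1 h2 => gt0_ltr_powR nR0 h1 h2 ans.
  rewrite !nnegrE powR_ge0 (ltW s0) => /(_ isT isT); rewrite -powRrM mulVf ?pnatr_eq0 -?lt0n//.
  by rewrite powRr1// powR_mulrn ?(ltW s0).
exists (inf E); split => //.
  by apply: lb_le_inf => // _ [k _ <-]; exact: powR_ge0.
apply/cvgrPdist_le => e e0.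
suff : \forall k \near \oo, powR (a k) k%:R^-1 <= inf E + e.
  apply: filterS2 (nbhs_infty_gt 0) => k k0 ale.
  rewrite distrC ger0_norm ?subr_ge0 ?infE//.
  by rewrite lerBlDl.
(* The geometric bound requires a rate below 1; otherwise the bound of the sequence by 1 already
   suffices. *)
have [L1|L1] := leP 1 (inf E + e).
  near=> k; apply: le_trans L1.
  rewrite [leRHS](_ : 1 = powR 1 k%:R^-1); last by rewrite powR1.
  have ki0 : 0 <= k%:R^-1 :> R by rewrite invr_ge0.
  by apply: (ge0_ler_powR ki0); rewrite ?nnegrE.
have L0 : 0 <= inf E by apply: lb_le_inf => // _ [k _ <-]; exact: powR_ge0.
have [|n n0 an] := Ltwit (inf E + e / 2); first lra.
have [|||||||K aK] := @nonincreasing_geometric_bound a (inf E + e / 2) n 0 1.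
- by move=> k; rewrite -addn1 (le_trans (amul _ _))// ler_piMr.
- lra.
- lra.
- by [].
- by [].
- by [].
- move=> j; rewrite add0n mul1r exprM.
  elim: j => [|j IH]; first by rewrite muln0 expr0.
  rewrite mulnS (le_trans (amul _ _))// exprS; apply: ler_pM => //; exact: ltW.
apply: (@near_root_le _ K (inf E + e / 2)) => //; lra.
Unshelve. all: by end_near.
Qed.

End RootSequences.

(** * The order defined by a proper cone *)

Section ConeOrder.
Context {R : realType} {X : completeNormedModType R} {C : set X}.
Context (properC : proper_cone C).
Implicit Types (x y z : X) (a b c t : R).

Local Notation "x <=C y" := (cone_le C x y) (at level 70).

Lemma cone_scale t x : 0 <= t -> C x -> C (t *: x).
Proof. by case: properC => coneC _ _ _; exact: coneC. Qed.

(** Convexity gives the midpoint, and the cone property doubles it. *)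
Lemma cone_add x y : C x -> C y -> C (x + y).
Proof.
case: properC => coneC _ convC _ Cx Cy.
have h0 : 0 <= 2^-1 :> R by rewrite invr_ge0.
have h1 : 2^-1 <= 1 :> R by rewrite invf_le1// ler1n.
have := convC x y (Itv01 h0 h1); rewrite !inE => /(_ Cx Cy) Cxy.
have : C (2^-1 *: x + (1 - 2^-1) *: y) by exact: Cxy.
rewrite (_ : 1 - 2^-1 = 2^-1); last by field.
move=> /(coneC 2 _ (ler0n _ _)).
by rewrite -scalerDr scalerA divff// scale1r.
Qed.

Lemma cone0 : C 0.
Proof. by case: properC => _ _ _ CN; have [] : (C `&` -%R @` C) 0 by rewrite CN. Qed.

Lemma cle_refl x : x <=C x.
Proof. by rewrite /cone_le subrr; exact: cone0. Qed.

Lemma cle_trans y x z : x <=C y -> y <=C z -> x <=C z.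
Proof. by move=> xy /cone_add/(_ xy); rewrite /cone_le addrA subrK. Qed.

Lemma cleD x y z w : x <=C y -> z <=C w -> x + z <=C y + w.
Proof. by rewrite /cone_le opprD addrACA; exact: cone_add. Qed.

Lemma cleZ t x y : 0 <= t -> x <=C y -> t *: x <=C t *: y.
Proof. by rewrite /cone_le -scalerBr; exact: cone_scale. Qed.

Lemma cleN x y : (- x <=C - y) = (y <=C x).
Proof. by rewrite /cone_le opprK addrC. Qed.

Lemma cleD2l z x y : (z + x <=C z + y) = (x <=C y).
Proof. by rewrite /cone_le opprD addrACA subrr add0r. Qed.

Lemma cle_pscale t x y : 0 < t -> t *: x <=C t *: y -> x <=C y.
Proof.
move=> t0 /(@cleZ t^-1); rewrite !scalerA mulVf ?gt_eqF// !scale1r; apply.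
by rewrite invr_ge0 ltW.
Qed.

Lemma cle_shift_trans y z x v a b :
  x <=C y + a *: v -> y <=C z + b *: v -> x <=C z + (a + b) *: v.
Proof.
move=> xy yz; apply: cle_trans xy _.
by rewrite addrC [a + b]addrC scalerDl addrA [_ + a *: v]addrC cleD2l.
Qed.

Lemma cle_scalel a b x : C x -> a <= b -> a *: x <=C b *: x.
Proof. by move=> Cx ab; rewrite /cone_le -scalerBl; apply: cone_scale; rewrite ?subr_ge0. Qed.

Lemma cle_anti x y : x <=C y -> y <=C x -> x = y.
Proof.
case: properC => _ _ _ CN xy yx; apply/eqP; rewrite eq_sym -subr_eq0; apply/eqP.
have : [set 0] (y - x) by rewrite -CN; split => //; exists (x - y); rewrite ?opprB.
by [].
Qed.

(** An interior point is an order unit, with a constant linear in the norm: if the ball of radius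
    [e] about [x] lies in [C], then [y] rescaled to norm [e / 2] may be subtracted from [x]. *)
Lemma interior_cone_unit x : C° x ->
  exists2 K, 0 < K & forall y, y <=C (K * `|y|) *: x.
Proof.
rewrite /interior/= => /nbhs_normP [e /= e0 ballC].
have Cx : C x by by apply: ballC; rewrite /ball_/= subrr normr0.
exists (2 / e) => [|y]; first by rewrite divr_gt0.
have [->|y0] := eqVneq y 0.
  by rewrite normr0 mulr0 scale0r /cone_le subr0 -(scale0r x); exact: cone_scale.
have ny0 : 0 < `|y| by rewrite normr_gt0.
pose t := 2 / e * `|y|.
have t0 : 0 < t by rewrite mulr_gt0// divr_gt0.
have : C (x - t^-1 *: y).
  apply: ballC; rewrite /ball_/= opprB addrC subrK normrZ gtr0_norm ?invr_gt0//.
  rewrite /t invfM -mulrA mulVf ?gt_eqF// mulr1 invf_div.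
  by rewrite ltr_pdivrMr// ltr_pMr// ltr1n.
move=> /(cone_scale (ltW t0)).
by rewrite scalerBr scalerA divff ?gt_eqF// scale1r.
Qed.

End ConeOrder.

(** * The interior of the cone and limits, in terms of one interior point *)

Section InteriorPoint.
Context {R : realType} {X : completeNormedModType R} {C : set X} {v : X}.
Context (properC : proper_cone C) (Cv : C° v).
Implicit Types (x y z : X) (a b c t : R).

Local Notation "x <=C y" := (cone_le C x y) (at level 70).

Lemma cone_point : C v.
Proof. exact: interior_subset Cv. Qed.

(** This replaces topology by order. In the converse direction, a perturbation of norm below [a / K]
    is absorbed by [a *: v]. *)
Lemma interior_coneP x : C° x <-> exists2 a, 0 < a & a *: v <=C x.
Proof.
split=> [Cx|[a a0 avx]].
  have [K K0 /(_ v) vx] := interior_cone_unit properC Cx.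
  have K1 : 0 < K * `|v| + 1 by rewrite ltr_wpDl// mulr_ge0// ltW.
  exists (K * `|v| + 1)^-1; first by rewrite invr_gt0.
  rewrite -[X in _ <=C X](@scalerK _ _ (K * `|v| + 1)) ?gt_eqF//.
  apply: (cleZ properC); first by rewrite invr_ge0 ltW.
  apply: (cle_trans properC) vx _; apply: (cle_scalel properC).
    exact: interior_subset Cx.
  by rewrite lerDl.
have [K K0 Kv] := interior_cone_unit properC Cv.
apply/nbhs_normP; exists (a / K) => /=; first exact: divr_gt0.
move=> y; rewrite /ball_/= ltr_pdivlMr// => xya.
have : C (a *: v - (x - y)).
  apply: (cle_trans properC (Kv _)); apply: (cle_scalel properC cone_point).
  by rewrite mulrC ltW.
by move=> /(cone_add properC avx); rewrite addrA subrK opprB addrC subrK.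
Qed.

Lemma interior_cone_add x y : C° x -> x <=C y -> C° y.
Proof.
move=> /interior_coneP[a a0 avx] xy; apply/interior_coneP; exists a => //.
exact: (cle_trans properC avx).
Qed.

(** The cone is closed, so [e] may tend to 0 from the right. *)
Lemma cle_archimedean x y :
  (forall e : R, 0 < e -> x <=C y + e *: v) -> x <=C y.
Proof.
case: (properC) => _ closedC _ _ xy; rewrite /cone_le.
apply: (@closed_cvg _ _ (0 : R)^'+ _ (fun e => y + e *: v - x) C closedC).
  near=> e; apply: xy; near: e; exact: nbhs_right_gt.
apply: cvg_at_right_filter; rewrite -[X in _ --> (X - x)]addr0 -(scale0r v).
by apply: cvgB; [apply: cvgD; [exact: cvg_cst|exact: cvgZr_tmp]|exact: cvg_cst].
Unshelve. all: by end_near.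
Qed.

End InteriorPoint.

(** * The gauges relative to [v], and the metrics expressed through them *)

Lemma inf_minimum (R : realType) (S : set R) (m : R) :
  S m -> lbound S m -> inf S = m.
Proof.
move=> Sm lbm; apply/eqP; rewrite eq_le ge_inf//=; last by exists m.
by apply: lb_le_inf => //; exists m.
Qed.

Lemma sup_maximum (R : realType) (S : set R) (m : R) :
  S m -> ubound S m -> sup S = m.
Proof.
move=> Sm ubm; apply/eqP; rewrite eq_le ge_sup//=; last by exists m.
by apply: ub_le_sup => //; exists m.
Qed.

Section Gauges.
Context {R : realType} {X : completeNormedModType R} {C : set X} {v : X}.
Context (properC : proper_cone C) (Cv : C° v) (v_neq0 : v != 0).
Implicit Types (x y z : X) (a b c t : R).

Local Notation "x <=C y" := (cone_le C x y) (at level 70).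
Local Notation top x := (cone_M C x v).
Local Notation bot x := (cone_m C x v).
Local Notation omega := (cone_omega C v).

(** A reversed strict inequality would, by pointedness, equate two distinct multiples of the nonzero
    vector [v]. *)
Lemma scalev_le a b : (a *: v <=C b *: v) <-> a <= b.
Proof.
split=> [avbv|]; last by apply: (cle_scalel properC); exact: cone_point Cv.
rewrite leNgt; apply/negP => ba.
have bvav := cle_scalel properC (cone_point Cv) (ltW ba).
have /eqP := cle_anti properC avbv bvav.
by rewrite -subr_eq0 -scalerBl scaler_eq0 (negbTE v_neq0) orbF subr_eq0 gt_eqF.
Qed.

(** The infimum is attained, by the archimedean property; this is what makes the bound an
    equivalence. *)
Lemma cone_M_leP x b : (x <=C b *: v) <-> top x <= b.
Proof.
have [K K0 Kv] := interior_cone_unit properC Cv.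
have lbS : has_lbound [set b | x <=C b *: v].
  exists (- (K * `|x|)) => c /= xc; apply/scalev_le.
  apply: (cle_trans properC) xc; rewrite scaleNr -[X in _ <=C X]opprK.
  by rewrite cleN -normrN; exact: Kv.
have S0 : [set b | x <=C b *: v] !=set0 by exists (K * `|x|); exact: Kv.
split=> [xb|xb]; first exact: ge_inf.
apply: (cle_trans properC) (cle_scalel properC (cone_point Cv) xb).
apply: (cle_archimedean (v := v) properC) => e e0.
have [|c xc ce] := @inf_lt _ _ (top x + e) S0; first by rewrite ltrDl.
rewrite -scalerDl; apply: (cle_trans properC xc).
by apply: (cle_scalel properC (cone_point Cv)); exact: ltW.
Qed.

(** Negation exchanges the two gauges, so the facts on [bot] follow from those on [top]. *)
Lemma cone_mE x : bot x = - top (- x).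
Proof.
rewrite /cone_m /cone_M /inf opprK; congr sup; apply/seteqP; split=> a /=.
  by move=> ax; exists (- a); rewrite ?opprK// scaleNr cleN.
by move=> [b xb <-]; rewrite scaleNr -[x]opprK cleN.
Qed.

Lemma cone_m_geP x a : (a *: v <=C x) <-> a <= bot x.
Proof.
rewrite cone_mE lerNr -cone_M_leP scaleNr cleN.
by [].
Qed.

Lemma le_cone_M x : x <=C top x *: v.
Proof. exact/cone_M_leP. Qed.

Lemma cone_m_le x : bot x *: v <=C x.
Proof. exact/cone_m_geP. Qed.

Lemma cone_m_le_M x : bot x <= top x.
Proof. by apply/scalev_le; exact: (cle_trans properC (cone_m_le x) (le_cone_M x)). Qed.

Lemma cone_m_gt0 x : C° x -> 0 < bot x.
Proof.
move=> /(interior_coneP properC Cv)[a a0 ax].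
by apply: lt_le_trans a0 _; exact/cone_m_geP.
Qed.

Lemma cone_omegaE x : omega x = top x - bot x.
Proof.
apply: inf_minimum => /=.
  by exists (bot x), (top x); split => //; [exact: cone_m_le|exact: le_cone_M].
move=> _ [a [b [/cone_m_geP ax /cone_M_leP xb ->]]].
by rewrite lerB.
Qed.

Lemma cone_omega_ge0 x : 0 <= omega x.
Proof. by rewrite cone_omegaE subr_ge0 cone_m_le_M. Qed.

Lemma cone_omega_le x a b : a *: v <=C x -> x <=C b *: v -> omega x <= b - a.
Proof. by move=> /cone_m_geP ax /cone_M_leP xb; rewrite cone_omegaE lerB. Qed.

(** The metrics measure [mu *: v] against [x], whereas [bot] and [top] measure [x] against [v];
    exchanging the roles inverts the gauges and swaps them. *)
Lemma cone_M_scalev mu x : 0 < mu -> C° x ->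
  cone_M C (mu *: v) x = mu / bot x.
Proof.
move=> mu0 Cx; have b0 := cone_m_gt0 Cx.
apply: inf_minimum => [/=|c /= vcx].
  have -> : mu *: v = (mu / bot x) *: (bot x *: v).
    by rewrite scalerA divfK ?gt_eqF.
  apply: (cleZ properC); last exact: cone_m_le.
  by rewrite divr_ge0 ?ltW.
have c0 : 0 < c.
  rewrite ltNge; apply/negP => c0.
  have Cx' := interior_subset Cx.
  have := cle_trans properC vcx (cle_scalel properC Cx' c0).
  by rewrite scale0r -(scale0r v) => /scalev_le; rewrite leNgt mu0.
rewrite ler_pdivrMr// mulrC -ler_pdivrMr//; apply/cone_m_geP.
have ci : 0 <= c^-1 by rewrite invr_ge0 ltW.
by have := cleZ properC ci vcx; rewrite !scalerA mulVf ?gt_eqF// scale1r mulrC.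
Qed.

Lemma cone_m_scalev mu x : 0 < mu -> C° x ->
  cone_m C (mu *: v) x = mu / top x.
Proof.
move=> mu0 Cx; have b0 := lt_le_trans (cone_m_gt0 Cx) (cone_m_le_M x).
apply: sup_maximum => [/=|c /= cxv].
  have -> : mu *: v = (mu / top x) *: (top x *: v).
    by rewrite scalerA divfK ?gt_eqF.
  apply: (cleZ properC); last exact: le_cone_M.
  by rewrite divr_ge0 ?ltW.
have [c0|c0] := leP c 0.
  by apply: (le_trans c0); rewrite divr_ge0 ?ltW.
rewrite ler_pdivlMr// mulrC -ler_pdivlMr//; apply/cone_M_leP.
have ci : 0 <= c^-1 by rewrite invr_ge0 ltW.
by have := cleZ properC ci cxv; rewrite !scalerA mulVf ?gt_eqF// scale1r mulrC.
Qed.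

Lemma hilbert_metricE x : C° x ->
  hilbert_metric C x v = ln (top x) - ln (bot x).
Proof.
move=> Cx; have b0 := cone_m_gt0 Cx.
have t0 := lt_le_trans b0 (cone_m_le_M x).
rewrite /hilbert_metric -{1 2}[v]scale1r cone_M_scalev// cone_m_scalev//.
by rewrite !div1r !lnV ?posrE//; lra.
Qed.

Lemma hilbert_metric_ge0 x : C° x -> 0 <= hilbert_metric C x v.
Proof.
move=> Cx; have b0 := cone_m_gt0 Cx.
rewrite hilbert_metricE// subr_ge0 ler_ln ?posrE ?cone_m_le_M//.
exact: lt_le_trans b0 (cone_m_le_M x).
Qed.

(** The distance is the logarithm of [top x / bot x = 1 + omega x / bot x]. *)
Lemma hilbert_metric_le x : C° x -> hilbert_metric C x v <= omega x / bot x.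
Proof.
move=> Cx; have b0 := cone_m_gt0 Cx.
have t0 := lt_le_trans b0 (cone_m_le_M x).
rewrite hilbert_metricE// -ln_div ?posrE//.
have -> : top x / bot x = 1 + omega x / bot x.
  by rewrite cone_omegaE; field; rewrite gt_eqF.
by apply: le_ln1Dx; rewrite (lt_le_trans (ltrN10 _))// divr_ge0 ?cone_omega_ge0// ltW.
Qed.

(** Thompson's distance is the larger of [ln lam - ln (bot x)] and [ln (top x) - ln lam], which are
    nonnegative and add up to Hilbert's distance. *)
Lemma thompson_metric_le_hilbert x lam : C° x -> bot x <= lam -> lam <= top x ->
  0 <= thompson_metric C x (lam *: v) <= hilbert_metric C x v.
Proof.
move=> Cx bl lt; have b0 := cone_m_gt0 Cx.
have l0 := lt_le_trans b0 bl; have t0 := lt_le_trans l0 lt.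
rewrite /thompson_metric hilbert_metricE// cone_M_scalev// cone_m_scalev//.
rewrite !ln_div ?posrE//.
have h1 : ln (bot x) <= ln lam by rewrite ler_ln ?posrE.
have h2 : ln lam <= ln (top x) by rewrite ler_ln ?posrE.
by rewrite le_max ge_max; apply/andP; split; [apply/orP; left|apply/andP; split]; lra.
Qed.

End Gauges.

Lemma limn_esup_root_le (R : realType) (u : nat -> R) (L : R) :
  (forall k, 0 <= u k) -> 0 <= L -> L < 1 ->
  (forall s, L < s -> s < 1 -> exists K, forall k, u k <= K * s ^+ k) ->
  (limn_esup (fun k => (powR (u k) (k%:R^-1))%:E) <= L%:E)%E.
Proof.
move=> u0 L0 L1 uL; apply/lee_addgt0Pr => e e0.
(* The minimum keeps the rate below 1 and strictly below [L + e], which leaves room to absorb the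
   constant [K]. *)
pose s := L + Num.min (e / 2) ((1 - L) / 2).
have m0 : 0 < Num.min (e / 2) ((1 - L) / 2) by rewrite lt_min; apply/andP; split; lra.
have m1 : Num.min (e / 2) ((1 - L) / 2) <= e / 2 by rewrite ge_min lexx.
have m2 : Num.min (e / 2) ((1 - L) / 2) <= (1 - L) / 2 by rewrite ge_min lexx orbT.
have [||K uK] := uL s; [rewrite /s; lra|rewrite /s; lra|].
apply: limn_esup_le_near; near do rewrite -EFinD lee_fin.
by apply: (near_root_le u0 uK); rewrite /s; lra.
Unshelve. all: by end_near.
Qed.

(** * The spectral radius of a map that does not increase [omega] *)

Section SpectralRadius.
Context {R : realType} {X : completeNormedModType R} (omega : X -> R) (h : X -> X).
Context (omega0 : forall x, 0 <= omega x).
Context (hle : forall x, omega (h x) <= omega x).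

Let A n := seminorm_of_map omega (iter n h).

Lemma omega_iter_le n x : omega (iter n h x) <= omega x.
Proof. by elim: n => //= n IH; exact: le_trans IH. Qed.

Lemma seminorm_of_map_itv n : (0 <= A n <= 1)%E.
Proof.
apply/andP; split; first by apply: ereal_sup_ubound; left.
apply: ge_ereal_sup => _ [->|[x /= x0 <-]]; first exact: lee01.
by rewrite lee_fin ler_pdivrMr ?mul1r ?omega_iter_le// lt_neqAle eq_sym x0 omega0.
Qed.

Lemma seminorm_of_map_fineK n : (fine (A n))%:E = A n.
Proof.
apply: fineK; have /andP[a0 a1] := seminorm_of_map_itv n.
by rewrite ge0_fin_numE// (le_lt_trans a1)// ltry.
Qed.

Lemma omega_iter_le_seminorm n x :
  omega (iter n h x) <= fine (A n) * omega x.
Proof.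
(* The supremum ignores the points where [omega] vanishes; there the iterates keep it equal to 0. *)
have [x0|x0] := eqVneq (omega x) 0.
  by rewrite x0 mulr0 -x0 omega_iter_le.
rewrite -ler_pdivrMr; last by rewrite lt_neqAle eq_sym x0 omega0.
rewrite -lee_fin seminorm_of_map_fineK; apply: ereal_sup_ubound; right.
by exists x.
Qed.

(** The seminorms of the iterates lie in [0, 1] and are submultiplicative, so their roots converge
    to a real number that is also their infimum; any rate above it is beaten by some iterate. *)
Lemma spectral_radius_nonexpansive :
  exists L : R, [/\ 0 <= L, spectral_radius omega h = L%:E &
    forall s, L < s -> exists n c, [/\ (0 < n)%N, 0 <= c, c < s ^+ n &
      forall x, omega (iter n h x) <= c * omega x]].
Proof.
pose a n := fine (A n).
have a01 n : 0 <= a n <= 1.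
  by have := seminorm_of_map_itv n; rewrite -seminorm_of_map_fineK !lee_fin.
have amul m n : a (m + n)%N <= a m * a n.
  have /andP[am0 _] := a01 m; have /andP[an0 _] := a01 n.
  rewrite -lee_fin seminorm_of_map_fineK.
  apply: ge_ereal_sup => _ [->|[x /= x0 <-]]; first by rewrite lee_fin mulr_ge0.
  have px : 0 < omega x by rewrite lt_neqAle eq_sym x0 omega0.
  rewrite lee_fin ler_pdivrMr// iterD (le_trans (omega_iter_le_seminorm m _))//.
  by rewrite -mulrA ler_wpM2l// omega_iter_le_seminorm.
have [L [L0 aL Lmin]] := submultiplicative_root_cvg a01 amul.
exists L; split => //.
  apply/cvg_lim => //.
  rewrite (_ : (fun _ => _) = EFin \o (fun k => powR (a k) k%:R^-1)).
    by apply: cvg_EFin aL; near=> k.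
  by apply/funext => k /=; rewrite -/(A k) -seminorm_of_map_fineK poweR_EFin.
move=> s Ls; have [n n0 an] := Lmin s Ls; exists n, (a n); split => //.
  by case/andP: (a01 n).
exact: omega_iter_le_seminorm.
Unshelve. all: by end_near.
Qed.

End SpectralRadius.

(** * First-order expansion in the order-unit norm, and properties of the semidifferential *)

Section OrderExpansion.
Context {R : realType} {X : completeNormedModType R} {C : set X} {v : X}.
Context (properC : proper_cone C) (Cv : C° v).
Implicit Types (x y z : X) (a b c e t : R) (f h : X -> X).

Local Notation "x <=C y" := (cone_le C x y) (at level 70).

Let Cpv : C v := cone_point Cv.

(** The ball of radius [c] for the order-unit norm of [v], stated by inequalities so that the norm
    itself need not be formed. *)
Definition unit_ball c x := (- c) *: v <=C x /\ x <=C c *: v.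

Lemma unit_ball_widen c c' x : c <= c' -> unit_ball c x -> unit_ball c' x.
Proof.
move=> cc' [x1 x2]; split; last exact: (cle_trans properC x2 (cle_scalel properC Cpv cc')).
by apply: (cle_trans properC) x1; apply: (cle_scalel properC Cpv); rewrite lerN2.
Qed.

Lemma unit_ballZ t c x : 0 <= t -> unit_ball c x -> unit_ball (t * c) (t *: x).
Proof.
by move=> t0 [x1 x2]; rewrite /unit_ball -mulrN -!scalerA; split; exact: cleZ.
Qed.

Lemma unit_ballDv c a x : unit_ball c x -> unit_ball (c + `|a|) (x + a *: v).
Proof.
move=> [x1 x2]; split; rewrite ?opprD scalerDl; apply: (cleD properC) => //;
  apply: (cle_scalel properC Cpv); [exact: lerNnormlW|exact: ler_norm].
Qed.

Lemma norm_unit_ball : exists2 K, 0 < K & forall x, unit_ball (K * `|x|) x.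
Proof.
have [K K0 Kv] := interior_cone_unit properC Cv; exists K => // x; split=> //.
by rewrite scaleNr -[x in X in _ <=C X]opprK cleN -normrN; exact: Kv.
Qed.

(** Normality enters here: [x + c *: v] lies between 0 and [(2 * c) *: v], so its norm is controlled
    by that of [v]. With [norm_unit_ball], the two norms are comparable. *)
Lemma unit_ball_norm : normal_cone C ->
  exists2 B, 0 < B & forall c x, 0 <= c -> unit_ball c x -> `|x| <= B * c.
Proof.
move=> [_ [M normalC]].
exists ((`|M| * 2 + 1) * (`|v| + 1)) => [|c x c0 [x1 x2]].
  by rewrite mulr_gt0// ltr_wpDl// mulr_ge0.
have n1 : `|x + c *: v| <= `|M| * (2 * c * `|v|).
  have xc0 : 0 <=C x + c *: v.
    by move: x1; rewrite /cone_le scaleNr opprK subr0.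
  have xcv : x + c *: v <=C (2 * c) *: v.
    by rewrite mulrDl mul1r scalerDl; apply: (cleD properC) => //; exact: (cle_refl properC).
  apply: le_trans (normalC _ _ xc0 xcv) _.
  rewrite normrZ ger0_norm ?mulr_ge0// ler_wpM2r ?mulr_ge0//.
  exact: ler_norm.
have n2 : `|x| <= `|x + c *: v| + c * `|v|.
  by rewrite -{1}[x](addrK (c *: v)) (le_trans (ler_normB _ _))// normrZ ger0_norm.
apply: (le_trans n2); apply: (le_trans (lerD n1 (lexx _))).
have -> : `|M| * (2 * c * `|v|) + c * `|v| = (`|M| * 2 + 1) * `|v| * c by ring.
by rewrite ler_wpM2r// ler_wpM2l ?lerDl// addr_ge0// mulr_ge0.
Qed.

(* Semidifferentiability at a fixed point v, with the norm of X replaced by the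
   order-unit norm of v. *)
Definition order_expansion f h := forall e, 0 < e -> exists2 d, 0 < d &
  forall c y, 0 <= c -> c <= d -> unit_ball c y ->
    v + h y <=C f (v + y) + (e * c) *: v /\
    f (v + y) <=C v + h y + (e * c) *: v.

Lemma interior_ball c y : c < 1 -> unit_ball c y -> C° (v + y).
Proof.
move=> c1 [y1 _]; apply/(interior_coneP properC Cv); exists (1 - c).
  by rewrite subr_gt0.
by rewrite scalerDl scale1r cleD2l.
Qed.

Section Semidifferential.
Context (f h : X -> X).
Context (f_mono : order_preserving_on C C° f) (f_hom : pos_homogeneous_on C° f).
Context (h_hom : pos_homogeneous_on setT h).
Context (fh : order_expansion f h).

(* Compare the expansions of f at v + ty and v + tz and let t tend to 0. *)
Lemma order_expansion_mono y z : y <=C z -> h y <=C h z.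
Proof.
move=> yz; have [K K0 Kb] := norm_unit_ball.
apply: (cle_archimedean (v := v) properC) => e e0.
pose c := K * (`|y| + `|z|) + 1.
have c0 : 0 < c by rewrite ltr_wpDl// mulr_ge0 ?addr_ge0// ltW.
have yc : unit_ball c y.
  by apply: unit_ball_widen (Kb y); rewrite /c mulrDr -addrA lerDl addr_ge0// mulr_ge0// ltW.
have zc : unit_ball c z.
  apply: unit_ball_widen (Kb z).
  by rewrite /c mulrDr addrAC lerDr addr_ge0// mulr_ge0// ltW.
have ec0 : 0 < e / (2 * c) by rewrite divr_gt0// mulr_gt0.
have [d d0 fd] := fh ec0.
(* The radius [t * c] is at most [d], where the expansion holds, and below 1, where [v + t *: y] and
   [v + t *: z] are interior. *)
pose t := Num.min d (1 / 2) / c.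
have m0 : 0 < Num.min d (1 / 2) by rewrite lt_min d0 divr_gt0.
have t0 : 0 < t by rewrite divr_gt0.
have tc : t * c = Num.min d (1 / 2) by rewrite divfK ?gt_eqF.
have tcd : t * c <= d by rewrite tc ge_min lexx.
have tc1 : t * c < 1 by rewrite tc gt_min; apply/orP; right; lra.
have tc0 : 0 <= t * c by rewrite tc ltW.
have yt := unit_ballZ (ltW t0) yc; have zt := unit_ballZ (ltW t0) zc.
have [fy _] := fd _ _ tc0 tcd yt; have [_ fz] := fd _ _ tc0 tcd zt.
have fyz : f (v + t *: y) <=C f (v + t *: z).
  apply: f_mono; [exact: interior_ball yt|exact: interior_ball zt|].
  by rewrite cleD2l; exact: (cleZ properC (ltW t0)).
have etc : e / (2 * c) * (t * c) = t * e / 2 by field; rewrite gt_eqF.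
move: fy fz; rewrite etc !h_hom// => fy fz.
have := cle_shift_trans properC (cle_trans properC fy _) fz.
have fyz' : f (v + t *: y) + (t * e / 2) *: v <=C f (v + t *: z) + (t * e / 2) *: v.
  by apply: (cleD properC) => //; exact: (cle_refl properC).
move=> /(_ _ fyz'); rewrite -addrA cleD2l (_ : _ + _ = t * e); last by field.
have -> : t *: h z + (t * e) *: v = t *: (h z + e *: v) by rewrite scalerDr scalerA.
exact: (cle_pscale properC).
Qed.

(** Since [v + t *: (y + a *: v) = (1 + t * a) *: (v + s *: y)] with [s = t / (1 + t * a)],
    homogeneity of [f] allows the expansions at both points to be compared for small [t]. *)
Let order_expansion_addv_le y a : h (y + a *: v) <=C h y + a *: v.
Proof.
have [K K0 Kb] := norm_unit_ball.
apply: (cle_archimedean (v := v) properC) => e e0.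
pose c := K * `|y| + 1; pose c' := c + `|a|.
have c0 : 0 < c by rewrite ltr_wpDl// mulr_ge0// ltW.
have cc' : c <= c' by rewrite lerDl.
have c'0 : 0 < c' by exact: lt_le_trans cc'.
have yc : unit_ball c y by apply: unit_ball_widen (Kb y); rewrite lerDl.
have yac := unit_ballDv a yc; rewrite -/c' in yac.
have ec0 : 0 < e / (2 * c') by rewrite divr_gt0// mulr_gt0.
have [d d0 fd] := fh ec0.
(* The bound 1/4 gives [1 + t * a >= 1 / 2], hence [s <= 2 * t]; the bound [d / 2] then keeps
   [s * c] within [d]. *)
pose t := Num.min (d / 2) (1 / 4) / c'.
have m0 : 0 < Num.min (d / 2) (1 / 4) by rewrite lt_min !divr_gt0.
have t0 : 0 < t by rewrite divr_gt0.
have tc : t * c' = Num.min (d / 2) (1 / 4) by rewrite divfK ?gt_eqF.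
have tcd : t * c' <= d / 2 by rewrite tc ge_min lexx.
have tc1 : t * c' <= 1 / 4 by rewrite tc ge_min lexx orbT.
have ta2 : `|t * a| <= 1 / 4.
  by rewrite normrM gtr0_norm// (le_trans _ tc1)// ler_wpM2l ?(ltW t0)// lerDr ltW.
have ta : 1 / 2 <= 1 + t * a by move: ta2; rewrite ler_norml => /andP[]; lra.
have ta0 : 0 < 1 + t * a by apply: lt_le_trans ta; lra.
pose s := t / (1 + t * a).
have s0 : 0 < s by rewrite divr_gt0.
have sE : (1 + t * a) * s = t by rewrite mulrC divfK ?gt_eqF.
have s2 : s <= 2 * t by rewrite ler_pdivrMr// -mulrA mulrCA ler_peMr ?(ltW t0)//; lra.
have sc2 : s * c <= 2 * (t * c').
  by rewrite mulrA; apply: ler_pM => //; exact: ltW.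
have scd : s * c <= d by lra.
have sc0 : 0 <= s * c by rewrite mulr_ge0 ?ltW.
have sc1 : s * c < 1 by lra.
have ys := unit_ballZ (ltW s0) yc; have yat := unit_ballZ (ltW t0) yac.
have tc0 : 0 <= t * c' by rewrite mulr_ge0 ?ltW.
have tcd' : t * c' <= d by lra.
have [fya _] := fd _ _ tc0 tcd' yat; have [_ fy] := fd _ _ sc0 scd ys.
have vE : v + t *: (y + a *: v) = (1 + t * a) *: (v + s *: y).
  rewrite !scalerDr !scalerA sE scalerDl scale1r -addrA; congr (_ + _).
  by rewrite addrC.
move: fya; rewrite vE f_hom//; last exact: interior_ball ys.
have := cleZ properC (ltW ta0) fy; rewrite !h_hom// => fy' fya.
have {fy'} : (1 + t * a) *: f (v + s *: y) <=C
     (v + t *: (h y + a *: v)) + (e / (2 * c') * (t * c)) *: v.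
  move: fy'; rewrite !scalerDr !scalerA sE [(1 + t * a) *: v]scalerDl scale1r.
  rewrite -!addrA (addrCA ((t * a) *: v) (t *: h y)).
  by rewrite mulrCA [_ * (s * c)]mulrA sE.
move=> /(cle_shift_trans properC fya).
rewrite -addrA cleD2l => hya; apply: (cle_pscale properC t0).
apply: (cle_trans properC hya).
rewrite [X in _ <=C X]scalerDr cleD2l scalerA; apply: (cle_scalel properC Cpv).
rewrite (_ : _ + _ = t * e * ((c' + c) / (2 * c'))); last by field; rewrite gt_eqF.
apply: ler_piMr; first by apply: mulr_ge0; exact: ltW.
by rewrite ler_pdivrMr ?mulr_gt0// mul1r; lra.
Qed.

(** The reverse inequality is the same one at [y + a *: v] with [- a]. *)
Lemma order_expansion_addv y a : h (y + a *: v) = h y + a *: v.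
Proof.
apply: (cle_anti properC) => //.
have := order_expansion_addv_le (y + a *: v) (- a).
rewrite scaleNr addrK => hy.
by have := cleD properC hy (cle_refl properC (a *: v)); rewrite subrK.
Qed.

End Semidifferential.
End OrderExpansion.

(** * From semidifferentiability to expansions of the iterates *)

Section Iteration.
Context {R : realType} {X : completeNormedModType R} {C : set X} {v : X}.
Context (properC : proper_cone C) (Cv : C° v).
Implicit Types (x y z : X) (a b c e t : R) (f h : X -> X).

Local Notation "x <=C y" := (cone_le C x y) (at level 70).

Let Cpv : C v := cone_point Cv.

Lemma semidifferential_order_expansion f h : normal_cone C -> f v = v ->
  is_semidifferential C° f v h -> @order_expansion _ _ C v f h.
Proof.
move=> normalC fv [_ _ _ /eqoP fh] e e0.
have [K K0 Kb] := norm_unit_ball properC Cv.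
have [B B0 Bb] := unit_ball_norm (v := v) properC normalC.
(* [B] is lost in passing from the order-unit norm of [y] to its norm, and [K] in passing back for
   the remainder. *)
have e'0 : 0 < e / (K * B) by rewrite divr_gt0// mulr_gt0.
have /nbhs_normP[r /= r0 fr] := fh _ e'0.
exists (r / (2 * B)); first by rewrite divr_gt0// mulr_gt0.
move=> c y c0 cr yc.
have yB := Bb _ _ c0 yc.
have yr : `|y| < r.
  move: cr; rewrite ler_pdivlMr ?mulr_gt0// => cr.
  by apply: (le_lt_trans yB); lra.
have := fr y; rewrite /ball_/= sub0r normrN => /(_ yr); rewrite fv => fy.
have gE : f (v + y) - v - h y = f (v + y) - (v + h y) by rewrite opprD addrA.
have := Kb (f (v + y) - v - h y).
have cE : K * `|f (v + y) - v - h y| <= e * c.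
  rewrite mulrC -ler_pdivlMr//; apply: (le_trans fy).
  apply: (@le_trans _ _ (e / (K * B) * (B * c))); first by rewrite ler_wpM2l// ltW.
  by rewrite le_eqVlt; apply/orP; left; apply/eqP; field; rewrite !gt_eqF.
move=> /(unit_ball_widen properC Cv cE); rewrite gE => -[fy1 fy2]; split.
  have := cleD properC fy1 (cle_refl properC (v + h y + (e * c) *: v)).
  by rewrite scaleNr [- _ + _]addrC addrK addrA subrK.
have := cleD properC fy2 (cle_refl properC (v + h y)).
by rewrite subrK [_ *: v + _]addrC.
Qed.

(** Put [f (v + y) = v + z]. Then [z] is close to [h y]; [iter n f] is expanded at [z], and
    [iter n h], monotone and commuting with multiples of [v], does not enlarge the error between [z]
    and [h y]. *)
Lemma order_expansion_iter f h n :
  {homo h : x y / cone_le C x y} -> (forall y a, h (y + a *: v) = h y + a *: v) ->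
  h 0 = 0 -> @order_expansion _ _ C v f h ->
  @order_expansion _ _ C v (iter n f) (iter n h).
Proof.
move=> hmono haddv h0 fh.
have hnmono k : {homo iter k h : x y / cone_le C x y}.
  by elim: k => //= k IH x y xy; exact/hmono/IH.
have hnaddv k y a : iter k h (y + a *: v) = iter k h y + a *: v.
  by elim: k => //= k ->.
have hv a : h (a *: v) = a *: v by rewrite -[a *: v]add0r haddv h0.
elim: n => [|n IH] e e0.
  exists 1 => // c y c0 _ _ /=; have ec : 0 <= e * c by rewrite mulr_ge0// ltW.
  have : v + y <=C v + y + (e * c) *: v.
    rewrite -{1}[v + y]addr0 cleD2l -(scale0r v).
    exact: (cle_scalel properC).
  by [].
(* Half of [e] is spent on the first step. The bound 1 keeps [z] in the ball of radius [2 * c],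
   which is why the other half appears below as [e / 4]. *)
pose e1 := Num.min (e / 2) 1.
have e10 : 0 < e1 by rewrite lt_min divr_gt0//=.
have e12 : e1 <= e / 2 by rewrite ge_min lexx.
have e11 : e1 <= 1 by rewrite ge_min lexx orbT.
have [d1 d10 fd1] := fh _ e10.
have [|dn dn0 fdn] := IH (e / 4); first by rewrite divr_gt0.
exists (Num.min d1 (dn / 2)); first by rewrite lt_min d10 divr_gt0.
move=> c y c0; rewrite le_min => /andP[cd1 cdn] yc.
have [fy1 fy2] := fd1 _ _ c0 cd1 yc.
pose z := f (v + y) - v.
have vz : v + z = f (v + y) by rewrite addrC subrK.
clearbody z.
have e1c : e1 * c <= c by rewrite ler_piMl.
have ec : e1 * c <= e / 2 * c by rewrite ler_wpM2r.
have c20 : 0 <= 2 * c by rewrite mulr_ge0.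
have c2d : 2 * c <= dn by lra.
move: fy1 fy2; rewrite -vz -!addrA !cleD2l => fy1 fy2.
have zc : unit_ball (C := C) (v := v) (2 * c) z.
  case: yc => /hmono; rewrite hv => y1 /hmono; rewrite hv => y2; split.
    have := cle_trans properC y1 fy1.
    move=> /(cleD properC)/(_ (cle_refl properC ((- c) *: v))).
    rewrite -addrA -!scalerDl (_ : - c + - c = - (2 * c)) => [z2c|]; last by ring.
    apply: (cle_trans properC z2c).
    have : (e1 * c + - c) *: v <=C 0 *: v by apply: (cle_scalel properC Cpv); lra.
    by move=> /(cleD properC (cle_refl properC z)); rewrite scale0r addr0.
  apply: (cle_trans properC fy2).
  apply: (cle_trans properC (cleD properC y2 (cle_refl properC _))).
  by rewrite -scalerDl; apply: (cle_scalel properC Cpv); lra.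
have [fz1 fz2] := fdn _ _ c20 c2d zc.
rewrite !iterSr -vz; split.
  have := hnmono n _ _ fy1; rewrite hnaddv -(cleD2l v) addrA.
  move=> /(cle_shift_trans properC)/(_ fz1) h1.
  apply: (cle_trans properC h1); rewrite cleD2l.
  by apply: (cle_scalel properC Cpv); lra.
have := hnmono n _ _ fy2; rewrite hnaddv -(cleD2l v) [X in _ <=C X]addrA => hz.
have h1 := cle_shift_trans properC fz2 hz.
apply: (cle_trans properC h1); rewrite [X in _ <=C X]addrA cleD2l.
by apply: (cle_scalel properC Cpv); lra.
Qed.

End Iteration.

(** * Contraction near the ray of [v], and attraction to it from the whole interior *)

Section Contraction.
Context {R : realType} {X : completeNormedModType R} {C : set X} {v : X}.
Context (properC : proper_cone C) (Cv : C° v) (v_neq0 : v != 0).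
Context (F : X -> X) (FC : set_fun C° C° F) (F_hom : pos_homogeneous_on C° F).
Context (F_mono : order_preserving_on C C° F) (Fv : F v = v).
Implicit Types (x y z u : X) (a b c e t d q : R).

Local Notation "x <=C y" := (cone_le C x y) (at level 70).
Local Notation top x := (cone_M C x v).
Local Notation bot x := (cone_m C x v).
Local Notation omega := (cone_omega C v).

Let Cpv : C v := cone_point Cv.
Let scalev_int c : 0 < c -> C° (c *: v).
Proof.
by move=> c0; apply/(interior_coneP properC Cv); exists c => //; exact: cle_refl.
Qed.

Let F_scalev c : 0 < c -> F (c *: v) = c *: v.
Proof. by move=> c0; rewrite F_hom// Fv. Qed.

(** [F] fixes the positive multiples of [v], so it preserves the inequality [bot x *: v <=C x]. *)
Lemma cone_m_nondecreasing x : C° x -> bot x <= bot (F x).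
Proof.
move=> Cx; have b0 := cone_m_gt0 properC Cv v_neq0 Cx.
apply/(cone_m_geP properC Cv v_neq0); rewrite -(F_scalev b0).
by apply: F_mono => //; [exact: scalev_int|exact: cone_m_le].
Qed.

Lemma cone_M_nonincreasing x : C° x -> top (F x) <= top x.
Proof.
move=> Cx; have b0 := cone_m_gt0 properC Cv v_neq0 Cx.
have t0 := lt_le_trans b0 (cone_m_le_M properC Cv v_neq0 x).
apply/(cone_M_leP properC Cv v_neq0); rewrite -(F_scalev t0).
by apply: F_mono => //; [exact: scalev_int|exact: le_cone_M].
Qed.

Lemma cone_omega_nonincreasing x : C° x -> omega (F x) <= omega x.
Proof.
move=> Cx; rewrite !(cone_omegaE properC Cv v_neq0).
by rewrite lerB ?cone_m_nondecreasing ?cone_M_nonincreasing.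
Qed.

Lemma cone_m_normalize x : C° x ->
  v <=C (bot x)^-1 *: x /\ (bot x)^-1 *: x <=C (top x / bot x) *: v.
Proof.
move=> Cx; have b0 := cone_m_gt0 properC Cv v_neq0 Cx.
have bi0 : 0 <= (bot x)^-1 by rewrite invr_ge0 ltW.
split.
  have := cleZ properC bi0 (cone_m_le properC Cv v_neq0 x).
  by rewrite scalerA mulVf ?gt_eqF// scale1r.
have := cleZ properC bi0 (le_cone_M properC Cv v_neq0 x).
by rewrite scalerA mulrC.
Qed.

(** The region amounts to [top u <= (1 + d) * bot u]: a Hilbert ball about [v], invariant under
    positive scaling. *)
Definition locally_contracting d q :=
  forall u, C° u -> omega u <= d * bot u -> omega (F u) <= q * omega u.

(** After division by [bot u], the point is [v + y] with [y] between 0 and [c *: v],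
    [c = omega u / bot u]. The linear scale of the error then matches [omega]. The error enters the
    upper and the lower bound, so half of the gap [q - a] is allowed for each. *)
Lemma order_expansion_locally_contracting (k : X -> X) a q :
  @order_expansion _ _ C v F k -> 0 <= a -> a < q ->
  (forall x, omega (k x) <= a * omega x) ->
  exists2 d, 0 < d & locally_contracting d q.
Proof.
move=> Fk a0 aq ka; have e0 : 0 < (q - a) / 2 by lra.
have [d d0 Fd] := Fk _ e0; exists d => // u Cu ud.
have b0 := cone_m_gt0 properC Cv v_neq0 Cu.
set b := bot u in ud b0 *; pose c := omega u / b.
have bi0 : 0 < b^-1 by rewrite invr_gt0.
have w0 : 0 <= omega u by exact: cone_omega_ge0.
have c0 : 0 <= c by rewrite divr_ge0// ltW.
have cd : c <= d by rewrite ler_pdivrMr.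
pose y := b^-1 *: u - v.
have [vw wv] := cone_m_normalize Cu; rewrite -/b in vw wv.
have vy : v + y = b^-1 *: u by rewrite addrC subrK.
have y0 : 0 *: v <=C y.
  by rewrite scale0r -(cleD2l v) addr0 vy.
have yc : y <=C c *: v.
  rewrite -(cleD2l v) vy -[X in X + c *: v]scale1r -scalerDl.
  rewrite (_ : 1 + c = top u / b)//.
  by rewrite /c (cone_omegaE properC Cv v_neq0) -/b; field; rewrite gt_eqF.
have yb : unit_ball (C := C) (v := v) c y.
  by split => //; apply: (cle_trans properC) y0; apply: (cle_scalel properC Cpv); lra.
have wy : omega y <= c.
  by rewrite -[c]subr0; exact: cone_omega_le.
have [Fy1 Fy2] := Fd _ _ c0 cd yb.
move: Fy1 Fy2; rewrite vy F_hom// => Fy1 Fy2.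
have kc : omega (k y) <= a * c by apply: (le_trans (ka y)); rewrite ler_wpM2l.
move: kc; rewrite (cone_omegaE properC Cv v_neq0) => kc.
set p := bot (k y) in kc; set P := top (k y) in kc.
set e := (q - a) / 2 in Fy1 Fy2 e0.
have lo : (1 + p - e * c) *: v <=C b^-1 *: F u.
  have pk := cleD properC (cle_refl properC v) (cone_m_le properC Cv v_neq0 (k y)).
  have := cleD properC (cle_trans properC pk Fy1) (cle_refl properC (- ((e * c) *: v))).
  by rewrite addrK !scalerDl scale1r scaleNr.
have hi : b^-1 *: F u <=C (1 + P + e * c) *: v.
  apply: (cle_trans properC Fy2); rewrite !scalerDl scale1r.
  apply: (cleD properC); last exact: cle_refl.
  by apply: (cleD properC); [exact: cle_refl|exact: le_cone_M].
have sc t : t *: v = b^-1 *: ((b * t) *: v) by rewrite scalerA mulKf ?gt_eqF.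
rewrite sc in lo; rewrite sc in hi.
have := cone_omega_le properC Cv v_neq0 (cle_pscale properC bi0 lo)
  (cle_pscale properC bi0 hi).
move=> /le_trans; apply; rewrite -mulrBr.
have -> : q * omega u = b * (q * c) by rewrite /c; field; rewrite gt_eqF.
rewrite ler_wpM2l ?(ltW b0)//.
have -> : q * c = a * c + 2 * (e * c) by rewrite /e; field.
lra.
Qed.

(* The segment from v to w = x / bot x meets the contraction region at a point z
   with z <= w <= al z; applying F, the contraction at z improves the bound on
   F x. *)
Lemma projective_ratio_contraction d q x : 0 < d -> 0 <= q ->
  locally_contracting d q -> C° x -> d * bot x < omega x ->
  top (F x) <= (1 + q * d) / (1 + d) * (top x / bot x) * bot (F x).
Proof.
move=> d0 q0 Fd Cx dx.
have b0 := cone_m_gt0 properC Cv v_neq0 Cx.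
set b := bot x in dx b0 *; set t := top x.
move: dx; rewrite (cone_omegaE properC Cv v_neq0) -/b -/t => dx.
have tb : b < t by have := mulr_gt0 d0 b0; lra.
have bi0 : 0 < b^-1 by rewrite invr_gt0.
pose T := t / b.
have TE : T - 1 = (t - b) / b by rewrite /T; field; rewrite gt_eqF.
have dT : d <= T - 1 by rewrite TE ler_pdivlMr// ltW.
have T1 : 0 < T - 1 by lra.
pose w := b^-1 *: x; have wE : w = b^-1 *: x by [].
have [vw wT] : v <=C w /\ w <=C T *: v by exact: cone_m_normalize.
clearbody w.
(* This value makes [(1 - tau) + tau * T] equal to [1 + d]; it is at most 1 because [x] lies outside
   the region. *)
pose tau := d / (T - 1).
have tau0 : 0 < tau by rewrite divr_gt0.
have tau1 : tau <= 1 by rewrite ler_pdivrMr// mul1r.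
have tauE : tau * (T - 1) = d by rewrite divfK ?gt_eqF.
pose z := (1 - tau) *: v + tau *: w.
have tau1' : 0 <= 1 - tau by rewrite subr_ge0.
have tauw u u' : u <=C u' -> tau *: u <=C tau *: u' by apply: (cleZ properC); exact: ltW.
have vz : 1 *: v <=C z.
  have -> : 1 *: v = (1 - tau) *: v + tau *: v by rewrite -scalerDl subrK.
  by apply: (cleD properC); [exact: cle_refl|exact: tauw].
have zd : z <=C (1 + d) *: v.
  have -> : (1 + d) *: v = (1 - tau) *: v + tau *: (T *: v).
    by rewrite scalerA -scalerDl -tauE; congr (_ *: _); ring.
  by apply: (cleD properC); [exact: cle_refl|exact: tauw].
have zw : z <=C w.
  have -> : (w : X) = (1 - tau) *: w + tau *: w by rewrite -scalerDl subrK scale1r.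
  by apply: (cleD properC); [exact: cleZ|exact: cle_refl].
pose al := T / (1 + d).
have al0 : 0 < al by rewrite divr_gt0; lra.
have alT : al * (1 + d) = T by rewrite divfK// gt_eqF//; lra.
have altau : 0 <= 1 - al * tau.
  have : al * tau * (1 + d) <= 1 * (1 + d) by rewrite mulrAC alT; lra.
  by rewrite ler_pM2r ?subr_ge0//; lra.
(* Split [w] with weights [1 - al * tau] and [al * tau], and bound the first copy by [T *: v]: the
   choice of [al] makes the result exactly [al *: z]. *)
have wz : w <=C al *: z.
  have -> : (w : X) = (1 - al * tau) *: w + (al * tau) *: w.
    by rewrite -scalerDl subrK scale1r.
  rewrite scalerDr [al *: (tau *: w)]scalerA.
  apply: (cleD properC); last exact: cle_refl.
  rewrite scalerA (_ : al * (1 - tau) = (1 - al * tau) * T); last first.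
    have TT : T = al * (1 + tau * (T - 1)) by rewrite tauE alT.
    by rewrite mulrBl mul1r {1}TT; ring.
  by rewrite -scalerA; exact: cleZ.
have Cz : C° z by apply/(interior_coneP properC Cv); exists 1.
have Cw : C° w by exact: (interior_cone_add properC Cv) Cz zw.
have bz : 1 <= bot z by apply/(cone_m_geP properC Cv v_neq0).
have oz : omega z <= d.
  by have := cone_omega_le properC Cv v_neq0 vz zd; lra.
have bFz := le_trans bz (cone_m_nondecreasing Cz).
have oFz : omega (F z) <= q * d.
  apply: (le_trans (Fd _ Cz _)); last by rewrite ler_wpM2l.
  by apply: (le_trans oz); rewrite ler_peMr// ltW.
(* As [bot (F z) >= 1], the absolute bound [q * d] on [omega (F z)] is also a relative one. *)
have tFz : top (F z) <= (1 + q * d) * bot (F z).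
  move: oFz; rewrite (cone_omegaE properC Cv v_neq0).
  have : q * d <= q * d * bot (F z) by rewrite ler_peMr// mulr_ge0// ltW.
  lra.
have FwE : F w = b^-1 *: F x by rewrite wE F_hom.
have Fzw : F z <=C F w by exact: F_mono.
have Caz : C° (al *: z).
  apply/(interior_coneP properC Cv); exists al => //.
  by have := cleZ properC (ltW al0) vz; rewrite scale1r.
have Fwz : F w <=C al *: F z by rewrite -F_hom//; exact: F_mono.
have h1 : bot (F z) * b <= bot (F x).
  apply/(cone_m_geP properC Cv v_neq0)/(cle_pscale properC bi0).
  rewrite scalerA mulrC mulfK ?gt_eqF// -FwE.
  exact: (cle_trans properC (cone_m_le properC Cv v_neq0 _) Fzw).
have h2 : top (F x) <= b * (al * top (F z)).
  apply/(cone_M_leP properC Cv v_neq0)/(cle_pscale properC bi0).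
  rewrite scalerA mulKf ?gt_eqF// -FwE -scalerA; apply: (cle_trans properC Fwz).
  by apply: (cleZ properC); [exact: ltW|exact: le_cone_M].
have -> : (1 + q * d) / (1 + d) * T = al * (1 + q * d).
  by rewrite /al; field; rewrite gt_eqF//; lra.
apply: (le_trans h2).
apply: (@le_trans _ _ (b * (al * ((1 + q * d) * bot (F z))))).
  by rewrite ler_wpM2l ?(ltW b0)// ler_wpM2l ?(ltW al0).
have -> : b * (al * ((1 + q * d) * bot (F z))) =
    al * (1 + q * d) * (bot (F z) * b) by ring.
by rewrite ler_wpM2l// mulr_ge0 ?(ltW al0)// addr_ge0// mulr_ge0// ltW.
Qed.

(** Outside the region each step multiplies the bound on [top / bot] by a fixed factor below 1;
    staying outside forever would bring this ratio below 1, against [bot <= top]. *)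
Lemma eventually_in_contraction_region d q x : 0 < d -> 0 <= q -> q < 1 ->
  locally_contracting d q -> C° x ->
  exists k, omega (iter k F x) <= d * bot (iter k F x).
Proof.
move=> d0 q0 q1 Fd Cx; apply: contrapT => /forallNP noreg.
have Ck k : C° (iter k F x) by elim: k => //= k; exact: FC.
have bk k := cone_m_gt0 properC Cv v_neq0 (Ck k).
pose r := (1 + q * d) / (1 + d).
have d1 : 0 < 1 + d by lra.
have r0 : 0 <= r by rewrite divr_ge0 ?ltW// ltr_wpDr// mulr_ge0// ltW.
have r1 : `|r| < 1.
  by rewrite ger0_norm// ltr_pdivrMr// mul1r ltrD2l gtr_pMl.
have ratio k : top (iter k F x) / bot (iter k F x) <= r ^+ k * (top x / bot x).
  elim: k => [|k IH]; first by rewrite mul1r.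
  rewrite exprS -mulrA ler_pdivrMr; last exact: (bk k.+1).
  have /negP := noreg k; rewrite -ltNge => dk.
  apply: (le_trans (projective_ratio_contraction d0 q0 Fd (Ck k) dk)).
  by apply: ler_wpM2r; [exact: ltW (bk k.+1)|exact: ler_wpM2l].
have T0 : 0 < top x / bot x.
  by rewrite divr_gt0 ?(bk 0%N)// (lt_le_trans (bk 0%N))//; exact: cone_m_le_M.
have Ti0 : 0 < (top x / bot x)^-1 by rewrite invr_gt0.
have /cvgrPdist_lt/(_ _ Ti0)[N _ /(_ N (leqnn N))] := cvg_expr r1.
rewrite /= sub0r normrN ger0_norm ?exprn_ge0// => rN.
have : 1 <= r ^+ N * (top x / bot x).
  apply: (le_trans _ (ratio N)); rewrite ler_pdivlMr// mul1r.
  exact: cone_m_le_M.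
by rewrite leNgt => /negP; apply; rewrite -ltr_pdivlMr// div1r.
Qed.

(** Once entered, the region is never left, since [omega] does not increase and [bot] does not
    decrease; the contraction thus applies at every later step. *)
Lemma eventually_geometric d q x : 0 < d -> 0 <= q -> q < 1 ->
  locally_contracting d q -> C° x ->
  exists k, forall j, omega (iter (k + j) F x) <= q ^+ j * omega (iter k F x).
Proof.
move=> d0 q0 q1 Fd Cx.
have [k kreg] := eventually_in_contraction_region d0 q0 q1 Fd Cx.
have Ck j : C° (iter j F x) by elim: j => //= j; exact: FC.
exists k => j.
suff [] : omega (iter (k + j) F x) <= q ^+ j * omega (iter k F x) /\
  omega (iter (k + j) F x) <= d * bot (iter (k + j) F x) by [].
elim: j => [|j [IH IHreg]]; first by rewrite addn0 mul1r.
rewrite addnS /=; have oF := Fd _ (Ck _) IHreg; split.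
  by rewrite exprS -mulrA (le_trans oF)// ler_wpM2l.
apply: (le_trans (cone_omega_nonincreasing (Ck _))); apply: (le_trans IHreg).
by rewrite ler_wpM2l ?(ltW d0)// cone_m_nondecreasing.
Qed.

End Contraction.

(** * Geometric decay of [omega] along the orbits of [f] *)

Section FixedPoint.
Context {R : realType} {X : completeNormedModType R} {C : set X} {v : X}.
Context (normalC : normal_cone C) (Cv : C° v) (v_neq0 : v != 0).
Context (f h : X -> X) (fC : set_fun C° C° f) (f_hom : pos_homogeneous_on C° f).
Context (f_mono : order_preserving_on C C° f) (fv : f v = v).
Context (fh : is_semidifferential C° f v h).

Local Notation omega := (cone_omega C v).

Let properC : proper_cone C := proj1 normalC.
Let h_hom : pos_homogeneous_on setT h. Proof. by case: fh. Qed.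
Let f_exp : @order_expansion _ _ C v f h.
Proof. exact: semidifferential_order_expansion. Qed.
Let h_mono := order_expansion_mono properC Cv f_mono h_hom f_exp.
Let h_addv := order_expansion_addv properC Cv f_hom h_hom f_exp.

Let h0 : h 0 = 0.
Proof.
(* Homogeneity is available for positive scalars only, so the value at 0 comes from
   [h 0 = 2 *: h 0]. *)
have := h_hom (ltr0n R 2) (I : setT (0 : X)); rewrite scaler0 => /eqP.
by rewrite scaler_nat mulr2n -subr_eq0 opprD addrA subrr sub0r oppr_eq0 => /eqP.
Qed.

(** [h] is monotone and fixes every multiple of [v], so it preserves both bounds on [x]. *)
Lemma semidifferential_omega_le x : omega (h x) <= omega x.
Proof.
rewrite [leRHS](cone_omegaE properC Cv v_neq0).
have hv a : h (a *: v) = a *: v by rewrite -[a *: v]add0r h_addv h0.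
apply: (cone_omega_le properC Cv v_neq0); rewrite -hv; apply: h_mono.
  exact: cone_m_le.
exact: le_cone_M.
Qed.

(** The contraction argument is applied to [iter n f] with factor [s ^+ n]; monotonicity of [omega]
    along the orbit of [f] fills in the indices between multiples of [n]. *)
Lemma iterates_omega_geometric x s n a : C° x -> 0 < s -> s < 1 ->
  (0 < n)%N -> 0 <= a -> a < s ^+ n ->
  (forall y, omega (iter n h y) <= a * omega y) ->
  exists K, forall k, omega (iter k f x) <= K * s ^+ k.
Proof.
move=> Cx s0 s1 n0 a0 asn hn.
have Ck k y : C° y -> C° (iter k f y) by move=> Cy; elim: k => //= k; exact: fC.
have FC : set_fun C° C° (iter n f) by move=> y; exact: Ck.
have F_hom : pos_homogeneous_on C° (iter n f).
  by move=> t y t0 Cy; elim: {1 2}n => //= k ->; rewrite f_hom//; exact: Ck.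
have F_mono : order_preserving_on C C° (iter n f).
  by move=> y z Cy Cz yz; elim: {1 2}n => //= k IH; apply: f_mono => //; exact: Ck.
have Fv : iter n f v = v by elim: (n) => //= k ->.
have F_exp := order_expansion_iter properC Cv n h_mono h_addv h0 f_exp.
have [d d0 Fd] := order_expansion_locally_contracting properC Cv v_neq0 F_hom
  F_exp a0 asn hn.
have sn0 : 0 <= s ^+ n by rewrite exprn_ge0// ltW.
have sn1 : s ^+ n < 1 by rewrite exprn_ilt1 ?(ltW s0)// -lt0n.
have [k Fk] := eventually_geometric properC Cv v_neq0 FC F_hom F_mono Fv
  d0 sn0 sn1 Fd Cx.
have wdec j : omega (iter j.+1 f x) <= omega (iter j f x).
  exact: (cone_omega_nonincreasing properC Cv v_neq0 f_hom f_mono fv (Ck j x Cx)).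
apply: (@nonincreasing_geometric_bound _ _ _ n (k * n) (omega x)) => //.
  exact: cone_omega_ge0.
move=> j; rewrite (_ : k * n + n * j = (k + j) * n)%N; last first.
  by rewrite mulnDl [(j * n)%N]mulnC.
rewrite iterM exprM mulrC (le_trans (Fk j))// ler_wpM2l ?exprn_ge0 ?(ltW s0)//.
have -> : iter k (iter n f) x = iter (k * n) f x by rewrite iterM.
by elim: (k * n)%N => // i; exact: le_trans.
Qed.

End FixedPoint.

(** * The degenerate case where 0 is interior to the cone *)

Section TrivialSpace.
Context {R : realType} {X : completeNormedModType R} {C : set X}.
Context (properC : proper_cone C) (C0 : C° 0).

(** If 0 is an order unit, both [x] and [- x] lie below 0. *)
Lemma interior_cone0_trivial (x : X) : x = 0.
Proof.
have [K K0 KC] := interior_cone_unit properC C0.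
apply: (cle_anti properC); first by move: (KC x); rewrite scaler0.
by move: (KC (- x)); rewrite scaler0 -{1}oppr0 cleN.
Qed.

Let setTE (T : Type) (P : T -> Prop) : (forall x, P x) -> [set x | P x] = setT.
Proof. by move=> PT; apply/seteqP; split=> // x _; exact: PT. Qed.

Let cleT (x y : X) : cone_le C x y.
Proof.
by rewrite /cone_le (interior_cone0_trivial (y - x)); exact: interior_subset C0.
Qed.

Let sup_setT : sup [set: R] = 0.
Proof.
apply: sup_out => -[_ [u ubu]].
by have := ubu (u + 1) I; rewrite gerDl ler10.
Qed.

Let inf_setT : inf [set: R] = 0.
Proof.
apply: inf_out => -[_ [u lbu]].
by have := lbu (u - 1) I; rewrite lerBrDl gerDr ler10.
Qed.

Lemma cone_M_trivial (x y : X) : cone_M C y x = 0.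
Proof. by rewrite /cone_M setTE. Qed.

Lemma cone_m_trivial (x y : X) : cone_m C y x = 0.
Proof. by rewrite /cone_m setTE. Qed.

Lemma cone_omega_trivial (v x : X) : cone_omega C v x = 0.
Proof.
rewrite /cone_omega setTE// => r; exists 0, r; split=> //.
by rewrite subr0.
Qed.

Lemma hilbert_metric_trivial (x y : X) : hilbert_metric C x y = 0.
Proof. by rewrite /hilbert_metric cone_M_trivial cone_m_trivial subrr. Qed.

Lemma thompson_metric_trivial (x y : X) : thompson_metric C x y = 0.
Proof.
by rewrite /thompson_metric cone_M_trivial cone_m_trivial ln0// oppr0 maxxx.
Qed.

End TrivialSpace.

(** * Convergence rates in both metrics *)

Theorem theorem7p8 (R : realType) (X : completeNormedModType R) (C : set X)
    (f : X -> X) (v : X) :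
  normal_cone C ->
  C° !=set0 ->
  set_fun C° C° f ->
  pos_homogeneous_on C° f ->
  order_preserving_on C C° f ->
  [set x | C° x /\ f x = x] v ->
  semidifferentiable C° f v ->
  (spectral_radius (cone_omega C v) (semidifferential C° f v) < 1)%E ->
  forall x : X, C° x ->
    (limn_esup (fun k : nat =>
       (powR (hilbert_metric C (iter k f x) v) (k%:R^-1))%:E)
     <= spectral_radius (cone_omega C v) (semidifferential C° f v))%E /\
    exists lam : R, 0 < lam /\
      (limn_esup (fun k : nat =>
         (powR (thompson_metric C (iter k f x) (lam *: v)) (k%:R^-1))%:E)
       <= spectral_radius (cone_omega C v) (semidifferential C° f v))%E.
Proof.
move=> normalC _ fC f_hom f_mono [Cv fv] fsemi; set h := semidifferential C° f v.
have fh : is_semidifferential C° f v h by exact: xgetPex.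
have properC := proj1 normalC.
(* If [v = 0] the space is trivial and both metrics vanish by convention; any positive [lam]
   serves. *)
have [v0|v_neq0] := eqVneq v 0.
  move: Cv; rewrite v0 => C0.
  have omega0 x : cone_omega C 0 x = 0 by exact: cone_omega_trivial.
  have [||L [L0 -> _]] := @spectral_radius_nonexpansive _ _ (cone_omega C 0) h.
  - by move=> x; rewrite omega0.
  - by move=> x; rewrite !omega0.
  rewrite lte_fin => L1 x _; split; last (exists 1; split=> //);
    apply: limn_esup_root_le => // [k|s _ _].
  - by rewrite hilbert_metric_trivial.
  - by exists 0 => k; rewrite hilbert_metric_trivial// mul0r.
  - by rewrite thompson_metric_trivial.
  - by exists 0 => k; rewrite thompson_metric_trivial// mul0r.
have [L [L0 -> Lmin]] := spectral_radius_nonexpansive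
  (cone_omega_ge0 properC Cv v_neq0)
  (semidifferential_omega_le normalC Cv v_neq0 f_hom f_mono fv fh).
rewrite lte_fin => L1 x Cx.
have Ck k : C° (iter k f x) by elim: k => //= k; exact: fC.
have bk k := cone_m_gt0 properC Cv v_neq0 (Ck k).
pose b k := cone_m C (iter k f x) v; pose t k := cone_M C (iter k f x) v.
have b_incr : {homo b : i j / (i <= j)%N >-> i <= j}.
  apply: homo_leq => [//|i j k|k]; first exact: le_trans.
  exact: (cone_m_nondecreasing properC Cv v_neq0 f_hom f_mono fv (Ck k)).
have t_decr : {homo t : i j / (i <= j)%N >-> j <= i}.
  apply: (homo_leq (r := fun x y => y <= x)) => [//|i j k ij jk|k].
    exact: le_trans jk ij.
  exact: (cone_M_nonincreasing properC Cv v_neq0 f_hom f_mono fv (Ck k)).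
(* Both sides are compared at the later of the two indices. *)
have bt i j : b i <= t j.
  apply: (@le_trans _ _ (b (maxn i j))); first by rewrite b_incr ?leq_maxl.
  apply: (@le_trans _ _ (t (maxn i j))); first exact: cone_m_le_M.
  by rewrite t_decr ?leq_maxr.
pose lam := sup (range b).
have b_lam k : b k <= lam.
  by apply: ub_le_sup; [exists (t 0%N) => _ [j _ <-]|exists k].
have lam_t k : lam <= t k.
  by apply: ge_sup; [exists (b 0%N), 0%N|move=> _ [j _ <-]].
have hb s : L < s -> s < 1 ->
    exists K, forall k, hilbert_metric C (iter k f x) v <= K * s ^+ k.
  move=> Ls s1; have s0 := le_lt_trans L0 Ls.
  have [n [a [n0 a0 asn hn]]] := Lmin s Ls.
  have [K wK] := iterates_omega_geometric normalC Cv v_neq0 fC f_hom f_mono fv fh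
    Cx s0 s1 n0 a0 asn hn.
  (* The bound on the distance divides by [b k], which is at least [b 0%N]. *)
  exists (K / b 0%N) => k.
  apply: (le_trans (hilbert_metric_le properC Cv v_neq0 (Ck k))).
  rewrite ler_pdivrMr ?bk//; apply: (le_trans (wK k)).
  have Ks : 0 <= K * s ^+ k by apply: le_trans (wK k); exact: cone_omega_ge0.
  have -> : K / b 0%N * s ^+ k * b k = K * s ^+ k * (b k / b 0%N) by ring.
  by apply: ler_peMr => //; rewrite ler_pdivlMr ?mul1r ?b_incr//; exact: (bk 0%N).
have thm k := thompson_metric_le_hilbert properC Cv v_neq0 (Ck k) (b_lam k) (lam_t k).
split.
  apply: limn_esup_root_le => // k; exact: hilbert_metric_ge0.
exists lam; split; first exact: lt_le_trans (bk 0%N) (b_lam 0%N).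
apply: limn_esup_root_le => // [k|s Ls s1]; first by case/andP: (thm k).
have [K hK] := hb s Ls s1; exists K => k.
by case/andP: (thm k) => _ /le_trans; apply.
Qed.
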